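(* Let $\mathcal{A}$ be an algorithm for matroid constrained maximization of set functions such that, for any monotone, non-negative function $g:2^W\to\mathbb{R}$ with $|W|=m$, generalized curvature $\alpha$ and submodularity ratio $\gamma$, algorithm $\mathcal{A}$ makes $O(q(m))$ queries to the value of $g$, where $q$ is a polynomial, and returns a solution with approximation ratio $R(\alpha,\gamma)$. If $f:2^{[n]}\to\mathbb{R}$ is a monotone, non-negative function with generalized curvature $\alpha$, submodularity ratio $\gamma$, and elementary submodular rank $r+1$, then the algorithm $r$-Split with subroutine $\mathcal{A}$ runs in time $O(2^r n^r q(n))$ and returns a solution with approximation ratio $\max\{R(\alpha,\gamma),R(\alpha_r,1)\}$.
   Context: Setting. $V=[n]$; set functions $f:2^V\to\mathbb{R}$ are identified with functions on $\{0,1\}^n$. $f$ is monotone if $f(A)\le f(B)$ for $A\subseteq B$. Matroid constrained maximization: given a matroid $\mathcal{M}\subseteq 2^V$ (family of independent sets), find $\max_{S\in\mathcal{M}}f(S)$. The approximation ratio is the returned value divided by the optimum value; ''approximation ratio $R$'' means this quotient is at least $R$. Discrete derivatives: $\Delta(S|T)=f(S\cup T)-f(T)$, $\Delta(e|T)=\Delta(\{e\}|T)$. For non-negative monotone $f$: - the submodularity ratio is $\gamma=\min\frac{\sum_{e\in S}\Delta(e|T)}{\Delta(S|T)}$ over $S,T\subseteq V$ with $S\cap T=\emptyset$ (quotients $0/0$ read as $1$); - the generalized curvature is the smallest $\alpha\in[0,1]$ such that $\Delta(e|(S\setminus\{e\})\cup T)\ge(1-\alpha)\Delta(e|S\setminus\{e\})$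 for all $S,T\subseteq V$, $e\in S\setminus T$. Elementary submodular rank. A tuple of linear orders $\pi_1,\ldots,\pi_n$ on $\{0,1\}$ gives a product lattice order on $\{0,1\}^n$; $f$ is $\pi$-submodular if $f(x)+f(y)\ge f(x\wedge y)+f(x\vee y)$ for all $x,y$, with meet and join for that order. $f$ is submodular if this holds with all $\pi_i$ the order $0<1$, and $\{i\}$-submodular if it holds with $\pi_i$ the order $1<0$ and all other $\pi_j$ the order $0<1$. The elementary submodular rank of $f$ is the smallest $r+1$ such that $f=f_0+f_{i_1}+\cdots+f_{i_r}$ with $f_0$ submodular and each $f_{i_j}$ $\{i_j\}$-submodular. Pieces. For $A\subseteq B\subseteq V$ let $\Pi(A,B)=\{C\subseteq V: C\cap B=A\}\cong 2^{V\setminus B}$ and let $f_{A,B}$ be the restriction of $f$ to $\Pi(A,B)$, regarded as a set function on $2^{V\setminus B}$; $\alpha_{A,B}$ and $\gamma_{A,B}$ denote its generalized curvature and submodularity ratio. Define $$\alpha_r=\min_{B\subseteq V,\,|B|\le r}\ \max_{A\subseteq B}\alpha_{A,B}.$$ Algorithm $r$-Split($f$, $r$, $\mathcal{A}$): for every pair $A\subseteq B\subseteq V$ with $|B|=r$, run $\mathcal{A}$ on $f_{A,B}$ (i.e. on maximizing $f$ over the sets of $\Pi(A,B)$ that lie in $\mathcal{M}$, when there are any); also run $\mathcal{A}$ on $f$; return the best set seen. Cost is measured in the same way as for $\mathcal{A}$, by value queries (plus comparisons of the returned values).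
   Formalization: The printed bound is false: α_r is replaced by the minimum over those B, |B| ≤ r, whose pieces are all submodular (the printed α_r when the two agree); R(·,1) is assumed non-increasing in the curvature on [0,1]; q is assumed positive at positive integers. *)

(* Defs.v *)
(* World: MathComp / MathComp-Analysis (an arbitrary R : realType as the reals). *)
From HB Require Import structures.
From mathcomp Require Import classical_sets reals.
From mathcomp Require Import all_boot all_order all_algebra.

Set Implicit Arguments.
Unset Strict Implicit.
Unset Printing Implicit Defensive.

Import Order.TTheory GRing.Theory Num.Theory.

Local Open Scope ring_scope.

Section SetFunctions.
Context {R : realType} {T : finType}.
Implicit Types (f : {set T} -> R) (A B S X Y : {set T}).

Definition monotone f : Prop := forall A B, A \subset B -> f A <= f B.

Definition nonnegative f : Prop := forall A, 0 <= f A.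

(* Quotients, with 0 / 0 read as 1. *)
Definition quot (x y : R) : R :=
  if (x == 0) && (y == 0) then 1 else x / y.

Definition deriv f S X : R := f (S :|: X) - f X.

(* The term S = set0 has quotient 0 / 0, so the default value 1 of the iterated
   minimum does not change it. *)
Definition submod_ratio f : R :=
  \big[Order.min/1]_(S : {set T})
    \big[Order.min/1]_(X : {set T} | [disjoint S & X])
      quot (\sum_(e in S) deriv f [set e] X) (deriv f S X).

(* For monotone f this set is closed and contains 1, so that its infimum is its
   smallest element. *)
Definition gen_curvature f : R :=
  inf [set a : R | 0 <= a <= 1 /\
    forall (S X : {set T}) (e : T), e \in S :\: X ->
      (1 - a) * deriv f [set e] (S :\ e)
        <= deriv f [set e] ((S :\ e) :|: X)]%classic.

(* A tuple of linear orders on {0,1} is encoded by pi : T -> bool, where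
   pi i = true stands for the order 1 < 0 and pi i = false for 0 < 1. *)
Definition pi_meet (pi : T -> bool) X Y : {set T} :=
  [set i | if pi i then (i \in X) || (i \in Y) else (i \in X) && (i \in Y)].

Definition pi_join (pi : T -> bool) X Y : {set T} :=
  [set i | if pi i then (i \in X) && (i \in Y) else (i \in X) || (i \in Y)].

Definition pi_submodular (pi : T -> bool) f : bool :=
  [forall X : {set T}, forall Y : {set T},
     f (pi_meet pi X Y) + f (pi_join pi X Y) <= f X + f Y].

Definition submodular f : bool := pi_submodular (fun=> false) f.

Definition elem_submodular (i : T) f : bool := pi_submodular (pred1 i) f.

Definition elem_decomposition f (r : nat) : Prop :=
  exists (f0 : {set T} -> R) (i : 'I_r -> T) (h : 'I_r -> {set T} -> R),
    [/\ submodular f0,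
        forall j, elem_submodular (i j) (h j) &
        forall S, f S = f0 S + \sum_(j < r) h j S].

(* k is the elementary submodular rank of f. *)
Definition elem_submodular_rank f (k : nat) : Prop :=
  exists r, [/\ k = r.+1, elem_decomposition f r &
                forall r', elem_decomposition f r' -> (r <= r')%N].

Definition matroid (M : {set {set T}}) : Prop :=
  [/\ set0 \in M,
      forall A B, B \in M -> A \subset B -> A \in M &
      forall A B, A \in M -> B \in M -> (#|A| < #|B|)%N ->
        exists2 e, e \in B :\: A & e |: A \in M].

(* The default value 0 is harmless for non-negative f and nonempty M. *)
Definition opt_value f (M : {set {set T}}) : R :=
  \big[Order.max/0]_(S in M) f S.

Definition approx_ratio f (M : {set {set T}}) S : R :=
  quot (f S) (opt_value f M).

End SetFunctions.

Section Pieces.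
Context {R : realType} {T : finType}.
Implicit Types (f : {set T} -> R) (A B : {set T}).

Definition outside (B : {set T}) : finType := {x : T | x \notin B}.

(* The element of Pi(A, B) corresponding to C, a subset of T \ B. *)
Definition in_piece A B (C : {set outside B}) : {set T} :=
  A :|: [set val x | x in C].

Definition piece f A B : {set outside B} -> R := fun C => f (in_piece A C).

Definition piece_matroid (M : {set {set T}}) A B : {set {set outside B}} :=
  [set C | in_piece A C \in M].

(* The generalized curvature takes values in [0, 1], so the default values 0
   and 1 below are neutral. *)
Definition max_curvature f B : R :=
  \big[Order.max/0]_(A : {set T} | A \subset B) gen_curvature (@piece f A B).

Definition alpha_r f (r : nat) : R :=
  \big[Order.min/1]_(B : {set T} | (#|B| <= r)%N) max_curvature f B.

Definition splits f B : bool :=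
  [forall A : {set T}, (A \subset B) ==> submodular (@piece f A B)].

(* As alpha_r, over those B whose pieces are all submodular.  Only such B give
   access to a guarantee at submodularity ratio 1, and they need not attain the
   minimum alpha_r.  For the rank 2 function
     f = 3 (x1 + x2 + x3 + x4) + x1 (x3 + x4) - x2 (x3 + x4)
   the pieces along {2} are supermodular, so that alpha_r f 1 = 0, but for no
   single index are both pieces modular.  A subroutine which is optimal on modular
   functions, and returns a worst feasible set for every other function of at most
   four variables, has guarantee 1 at (0, 1) and yet attains the maximum of f on
   the free matroid neither on f nor on any piece. *)
Definition alpha_split f (r : nat) : R :=
  \big[Order.min/1]_(B : {set T} | (#|B| <= r)%N && splits f B)
    max_curvature f B.

End Pieces.

(* Adaptive algorithms with value-oracle access to a set function on W. *)
Inductive qtree (R : Type) (W : finType) (X : Type) : Type :=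
| Ret of X
| Query of {set W} & (R -> qtree R W X).

Arguments Ret {R W X}.
Arguments Query {R W X}.

Section QueryTrees.
Context {R : Type} {W : finType}.

Fixpoint exec {X : Type} (g : {set W} -> R) (t : qtree R W X) : X :=
  match t with
  | Ret x => x
  | Query Q k => exec g (k (g Q))
  end.

Fixpoint nqueries {X : Type} (g : {set W} -> R) (t : qtree R W X) : nat :=
  match t with
  | Ret _ => 0
  | Query Q k => (nqueries g (k (g Q))).+1
  end.

Fixpoint bind {X Y : Type} (t : qtree R W X) (h : X -> qtree R W Y) :
    qtree R W Y :=
  match t with
  | Ret x => h x
  | Query Q k => Query Q (fun v => bind (k v) h)
  end.

(* Turns an algorithm on W into one on W' by replacing each query Q by phi Q. *)
Fixpoint reindex {W' : finType} {X : Type} (phi : {set W} -> {set W'})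
    (t : qtree R W X) : qtree R W' X :=
  match t with
  | Ret x => Ret x
  | Query Q k => Query (phi Q) (fun v => reindex phi (k v))
  end.

End QueryTrees.

(* An algorithm for matroid constrained maximization: it is given the ground set
   and the family of independent sets, and accesses the set function by value
   queries only. *)
Definition algorithm (R : Type) : Type :=
  forall W : finType, {set {set W}} -> qtree R W {set W}.

Section Split.
Context {R : realType} {T : finType}.

(* Runs the algorithms in ts one after the other, starting from the current best
   set S of value v.  The second component of the result counts the comparisons
   of values. *)
Fixpoint best_of (ts : seq (qtree R T {set T})) (S : {set T}) (v : R)
    (c : nat) : qtree R T ({set T} * nat) :=
  match ts with
  | [::] => Ret (S, c)
  | t :: ts' =>
      bind t (fun S' => Query S' (fun v' =>
        if v < v' then best_of ts' S' v' c.+1 else best_of ts' S v c.+1))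
  end.

Definition run_on_piece (Alg : algorithm R) (M : {set {set T}})
    (A B : {set T}) : qtree R T {set T} :=
  bind (reindex (@in_piece T A B) (Alg (outside B) (piece_matroid M A B)))
       (fun C => Ret (in_piece A C)).

Definition split_pairs (M : {set {set T}}) (r : nat) :
    seq ({set T} * {set T}) :=
  [seq p : {set T} * {set T} <- enum {: {set T} * {set T}} |
     [&& p.1 \subset p.2, #|p.2| == r & piece_matroid M p.1 p.2 != set0]].

Definition r_split (Alg : algorithm R) (r : nat) (M : {set {set T}}) :
    qtree R T ({set T} * nat) :=
  bind (Alg T M) (fun S => Query S (fun v =>
    best_of [seq run_on_piece Alg M p.1 p.2 | p <- split_pairs M r] S v 0)).

Definition split_solution (Alg : algorithm R) r M (f : {set T} -> R) : {set T} :=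
  (exec f (r_split Alg r M)).1.

(* Value queries plus comparisons. *)
Definition split_cost (Alg : algorithm R) r M (f : {set T} -> R) : nat :=
  nqueries f (r_split Alg r M) + (exec f (r_split Alg r M)).2.

End Split.

(* Main.v *)
Require Import Defs.
From HB Require Import structures.
From mathcomp Require Import classical_sets reals.
From mathcomp Require Import all_boot all_order all_algebra.
From mathcomp Require Import zify ring lra.
Import Order.TTheory GRing.Theory Num.Theory.
Local Open Scope ring_scope.

(** The approximation guarantee comes from a single good piece.  If f = f_0 + f_{i_1} + ... +
    f_{i_r} is an elementary decomposition and B contains every i_j, then the
    restriction of f to any piece Pi(A, B) is submodular: on sets with a common
    trace on B, the order reversed in coordinate i_j is never felt, so each
    summand is submodular there ([decomposition_splits]).  On such a piece the
    submodularity ratio is 1 ([submod_ratio1]), so the subroutine guarantees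
    R(alpha_{A,B}, 1).  Enlarging B only shrinks the pieces, hence preserves
    their submodularity ([splitsS]) and does not increase their curvature
    ([max_curvatureS]); so a set B of size at most r that attains [alpha_split]
    may be taken to have size exactly r, that is, to be one of the sets visited
    by the algorithm.  An optimal independent set O lies in the piece
    Pi(O :&: B, B), the independent sets of that piece form a contraction of the
    matroid ([piece_matroid_matroid]), and the optimum over the piece is the
    global optimum ([opt_value_piece]).  As the algorithm returns the best set
    seen, its ratio is at least R(alpha_{A,B}, 1) with A = O :&: B, which by
    antitonicity is at least R(alpha_split, 1).  The run on f itself gives
    R(alpha, gamma).

    For the cost, there are at most 2^r C(n, r) <= 2^r n^r pairs A \subset B
    ([size_split_pairs]), each costing one run on n - r variables, one query and
    one comparison.  The polynomial q need not be monotone, but a polynomial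
    positive at the positive integers lies between two positive multiples of the
    same power of n there, so q(m) <= C q(n) for 1 <= m <= n
    ([horner_quasi_monotone]).  The bound on the number of queries is about
    nonempty ground sets, so one needs n - r > 0.  This comes from minimality of
    the rank: every f on n >= 1 variables has an elementary decomposition with
    n - 1 elementary terms ([decomposition_pred]), namely multiples of the
    functions [i \in S] |S| for all i but one, large enough to make the
    remainder submodular. *)

(** * Pieces as subsets of the ground set *)

Section PieceCoordinates.
Set Implicit Arguments.
Context {T : finType}.
Implicit Types (A B P Q : {set T}).

Definition trace B P : {set outside B} := [set x | val x \in P].

Lemma val_in_piece A B (C : {set outside B}) (x : outside B) :
  A \subset B -> (val x \in in_piece A C) = (x \in C).
Proof.
move=> sAB; rewrite inE mem_imset; last exact: val_inj.
by case: (boolP (val x \in A)) => // /(subsetP sAB); rewrite (negbTE (valP x)).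
Qed.

Lemma in_piece_capB A B (C : {set outside B}) :
  A \subset B -> in_piece A C :&: B = A.
Proof.
move=> sAB; apply/setP=> z; rewrite !inE.
case: (boolP (z \in A)) => [/(subsetP sAB)-> //|_] /=.
by apply/andP=> -[/imsetP[x _ ->]]; rewrite (negbTE (valP x)).
Qed.

Lemma traceK A B P : P :&: B = A -> in_piece A (trace B P) = P.
Proof.
move=> <-; apply/setP=> z; rewrite !inE.
case: (boolP (z \in B)) => zB.
  rewrite andbT; case: (z \in P) => //=.
  by apply/imsetP=> -[x _ zx]; rewrite zx (negbTE (valP x)) in zB.
rewrite andbF /=; apply/imsetP/idP => [[x] | zP].
  by rewrite inE => xP ->.
by exists (Sub z zB : outside B); rewrite ?inE ?SubK.
Qed.

Lemma in_pieceU A B (C D : {set outside B}) :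
  in_piece A (C :|: D) = in_piece A C :|: in_piece A D.
Proof. by rewrite /in_piece imsetU setUUr. Qed.

Lemma in_pieceI A B (C D : {set outside B}) :
  in_piece A (C :&: D) = in_piece A C :&: in_piece A D.
Proof.
rewrite /in_piece imsetI; last by move=> ? ? _ _; apply: val_inj.
by rewrite setUIr.
Qed.

Lemma in_pieceU1 A B e (C : {set outside B}) :
  in_piece A (e |: C) = val e |: in_piece A C.
Proof. by rewrite /in_piece imsetU1 setUCA. Qed.

Lemma in_pieceS A B (C D : {set outside B}) :
  C \subset D -> in_piece A C \subset in_piece A D.
Proof. by move=> sCD; rewrite /in_piece setUS ?imsetS. Qed.

Lemma card_in_piece A B (C : {set outside B}) :
  A \subset B -> #|in_piece A C| = (#|A| + #|C|)%N.
Proof.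
move=> sAB; rewrite /in_piece cardsU card_imset; last exact: val_inj.
rewrite (_ : _ :&: _ = set0) ?cards0 ?subn0 //.
apply/setP=> z; rewrite !inE; apply/andP=> -[zA /imsetP[x _ zx]].
by have := subsetP sAB _ zA; rewrite zx (negbTE (valP x)).
Qed.

Lemma card_outside B : #|outside B| = (#|T| - #|B|)%N.
Proof. by rewrite -(cardsC B) addKn card_sub; apply: eq_card => x; rewrite !inE. Qed.

(** This is the contraction of M by A, restricted to the complement of B.
    Nonemptiness means that A is independent; the exchange axiom is inherited
    because [in_piece] shifts all cardinals by the same #|A|. *)
Lemma piece_matroid_matroid (M : {set {set T}}) A B :
  A \subset B -> matroid M -> piece_matroid M A B != set0 ->
  matroid (piece_matroid M A B).
Proof.
move=> sAB [M0 Mdown Mexch] /set0Pn[C0 C0M]; split=> [|C D|C D].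
- move: C0M; rewrite !inE => /Mdown; apply; exact/in_pieceS/sub0set.
- by rewrite !inE => DM /(in_pieceS A); apply: Mdown.
rewrite !inE => CM DM ltCD; have [|z] := Mexch _ _ CM DM.
  by rewrite !card_in_piece // ltn_add2l.
rewrite inE => /andP[zC zD] zM.
have zB: z \notin B.
  apply: contra zC => zB.
  rewrite (subsetP (subsetUl A _)) // -(in_piece_capB D sAB).
  by rewrite in_setI zD.
exists (Sub z zB : outside B); last by rewrite inE in_pieceU1 SubK.
by rewrite inE -!(val_in_piece _ _ sAB) SubK zC zD.
Qed.

End PieceCoordinates.

Section PieceFunctions.
Set Implicit Arguments.
Context {R : realType} {T : finType}.
Implicit Types (f : {set T} -> R) (A B P Q : {set T}).

Lemma piece_monotone f A B : monotone f -> monotone (@piece R T f A B).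
Proof. by move=> fM C D sCD; apply/fM/in_pieceS. Qed.

Lemma piece_nonnegative f A B : nonnegative f -> nonnegative (@piece R T f A B).
Proof. by move=> f0 C; apply: f0. Qed.

Lemma submodularP f :
  reflect (forall P Q, f (P :&: Q) + f (P :|: Q) <= f P + f Q) (submodular f).
Proof.
have eqI P Q : pi_meet (fun=> false) P Q = P :&: Q.
  by apply/setP=> x; rewrite !inE.
have eqU P Q : pi_join (fun=> false) P Q = P :|: Q.
  by apply/setP=> x; rewrite !inE.
apply: (iffP forallP) => [fS P Q | fS P].
  by have /forallP/(_ Q) := fS P; rewrite eqI eqU.
by apply/forallP=> Q; rewrite eqI eqU.
Qed.

End PieceFunctions.

(** * Submodularity on pieces *)

Section SubmodularPieces.
Set Implicit Arguments.
Context {R : realType} {T : finType}.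
Implicit Types (f : {set T} -> R) (A B P Q : {set T}).

(** Two sets lie in a common piece along B exactly when they have the same
    intersection with B. *)
Definition submodular_on B f : Prop :=
  forall P Q, P :&: B = Q :&: B -> f (P :&: Q) + f (P :|: Q) <= f P + f Q.

Lemma splitsP f B : reflect (submodular_on B f) (splits f B).
Proof.
apply: (iffP forallP) => [fS P Q eqPQ | fS A].
  have /implyP/(_ (subsetIr P B)) := fS (P :&: B).
  move=> /submodularP/(_ (trace B P) (trace B Q)).
  by rewrite /piece in_pieceI in_pieceU !traceK.
apply/implyP=> sAB; apply/submodularP=> C D.
rewrite /piece in_pieceI in_pieceU; apply: fS.
by rewrite !in_piece_capB.
Qed.

(** Agreeing on the larger set B' forces agreeing on B. *)
Lemma splitsS f B B' : B \subset B' -> splits f B -> splits f B'.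
Proof.
move=> sBB' /splitsP fB; apply/splitsP => P Q eqPQ; apply: fB.
by rewrite -(setIidPr sBB') !setIA eqPQ.
Qed.

End SubmodularPieces.

(** * Generalized curvature *)

Section Curvature.
Set Implicit Arguments.
Context {R : realType} {T : finType}.
Implicit Types (f : {set T} -> R) (P Q : {set T}).

(** Writing P = S :\ e and Q = P :|: X turns the defining condition of the
    generalized curvature into a comparison of derivatives along inclusions,
    which is easy to restrict to subfamilies of sets. *)
Definition curvature_bound f (a : R) : Prop :=
  forall P Q e, P \subset Q -> e \notin Q ->
    (1 - a) * Defs.deriv f [set e] P <= Defs.deriv f [set e] Q.

Lemma gen_curvatureE f :
  gen_curvature f = inf [set a : R | 0 <= a <= 1 /\ curvature_bound f a]%classic.
Proof.
congr inf; apply/seteqP; split=> a /= [a01 fa];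
  split=> //; [move=> P Q e sPQ eQ | move=> S X e].
  have eP : e \notin P by apply: contra eQ; apply: (subsetP sPQ).
  have := fa (e |: P) Q e; rewrite setU1K // (setUidPr sPQ); apply.
  by rewrite !inE eqxx eQ.
rewrite inE => /andP[eX eS]; apply: fa; first exact: subsetUl.
by rewrite !inE eqxx (negbTE eX).
Qed.

Lemma curvature_bound1 f : monotone f -> curvature_bound f 1.
Proof.
by move=> fM P Q e _ _; rewrite subrr mul0r subr_ge0; apply/fM/subsetUr.
Qed.

Lemma gen_curvature_ge0 f : monotone f -> 0 <= gen_curvature f.
Proof.
move=> fM; rewrite gen_curvatureE; apply: lb_le_inf.
  by exists 1; split; [rewrite ler01 lexx | apply: curvature_bound1].
by move=> a [/andP[]].
Qed.

Lemma gen_curvature_le1 f : monotone f -> gen_curvature f <= 1.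
Proof.
move=> fM; rewrite gen_curvatureE; apply: ge_inf.
  by exists 0 => a [/andP[]].
by split; [rewrite ler01 lexx | apply: curvature_bound1].
Qed.

End Curvature.

Section CurvatureComparison.
Set Implicit Arguments.
Context {R : realType} {T T' : finType}.

Lemma gen_curvature_le (f : {set T} -> R) (g : {set T'} -> R) : monotone f ->
  (forall a, curvature_bound f a -> curvature_bound g a) ->
  gen_curvature g <= gen_curvature f.
Proof.
move=> fM fg; rewrite !gen_curvatureE; apply: lb_le_inf.
  by exists 1; split; [rewrite ler01 lexx | apply: curvature_bound1].
move=> a [a01 fa]; apply: ge_inf; first by exists 0 => b [/andP[]].
by split=> //; apply: fg.
Qed.

End CurvatureComparison.

Section PieceCurvature.
Set Implicit Arguments.
Context {R : realType} {T : finType}.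
Implicit Types (f : {set T} -> R) (A B P Q : {set T}).

Lemma curvature_bound_piece f A B a : A \subset B ->
  curvature_bound (@piece R T f A B) a <->
  (forall P Q e, P :&: B = A -> Q :&: B = A -> P \subset Q ->
     e \notin B -> e \notin Q ->
     (1 - a) * Defs.deriv f [set e] P <= Defs.deriv f [set e] Q).
Proof.
move=> sAB; split=> [fa P Q e PA QA sPQ eB eQ | fa C D e sCD eD].
  have := fa (trace B P) (trace B Q) (Sub e eB).
  rewrite /Defs.deriv /piece !in_pieceU1 !traceK // SubK; apply; last by rewrite inE.
  by apply/subsetP=> x; rewrite !inE; apply: (subsetP sPQ).
rewrite /Defs.deriv /piece !in_pieceU1.
by apply: fa; rewrite ?in_piece_capB ?in_pieceS ?val_in_piece ?(valP e).
Qed.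

(** Pi(A', B') is contained in Pi(A' :&: B, B), so it imposes fewer conditions. *)
Lemma gen_curvature_piece_le f A' B B' : monotone f ->
  A' \subset B' -> B \subset B' ->
  gen_curvature (@piece R T f A' B') <= gen_curvature (@piece R T f (A' :&: B) B).
Proof.
move=> fM sAB' sBB'; apply: gen_curvature_le; first exact: piece_monotone.
move=> a /curvature_bound_piece fa; apply/curvature_bound_piece=> // P Q e PA QA.
move=> sPQ eB' eQ; apply: fa => //; first exact: subsetIr.
- by rewrite -PA -setIA (setIidPr sBB').
- by rewrite -QA -setIA (setIidPr sBB').
by apply: contra eB'; apply: (subsetP sBB').
Qed.

Lemma max_curvatureS f B B' : monotone f -> B \subset B' ->
  max_curvature f B' <= max_curvature f B.
Proof.
move=> fM sBB'; apply: bigmax_le => [|A sAB']; first exact: bigmax_ge_id.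
apply: le_trans (gen_curvature_piece_le fM sAB' sBB') _.
by apply: le_bigmax_cond; apply: subsetIr.
Qed.

Lemma max_curvature_le1 f B : monotone f -> max_curvature f B <= 1.
Proof.
move=> fM; apply: bigmax_le => // A _.
exact/gen_curvature_le1/piece_monotone.
Qed.

End PieceCurvature.

(** * The submodularity ratio of a submodular function *)

Section SubmodularityRatio.
Set Implicit Arguments.
Context {R : realType} {T : finType}.
Implicit Types (f : {set T} -> R) (S X : {set T}).

Lemma deriv_ge0 f S X : monotone f -> 0 <= Defs.deriv f S X.
Proof. by move=> fM; rewrite subr_ge0; apply/fM/subsetUr. Qed.

Lemma submodular_deriv_le f S X : submodular f ->
  Defs.deriv f S X <= \sum_(e in S) Defs.deriv f [set e] X.
Proof.
move=> /submodularP fS; have [k leSk] := ubnP #|S|.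
elim: k => // k IHk in S leSk *.
have [->|[e eS]] := set_0Vmem S; first by rewrite big_set0 /Defs.deriv set0U subrr.
rewrite (big_setD1 e) //=.
have {leSk}/IHk IH : (#|S :\ e| < k)%N by move: leSk; rewrite (cardsD1 e S) eS.
apply: le_trans (lerD (lexx _) IH); rewrite /Defs.deriv.
have := fS (e |: X) ((S :\ e) :|: X).
have -> : (e |: X) :&: ((S :\ e) :|: X) = X.
  by apply/setP=> x; rewrite !inE; case: (x == e); case: (x \in X); rewrite ?orbT ?andbF.
by rewrite -setUUl setD1K //; lra.
Qed.

(** All quotients are at least 1.  The delicate case is a zero denominator: then
    monotonicity makes every single-element derivative vanish as well, and the
    quotient is 0 / 0 = 1. *)
Lemma submod_ratio1 f : monotone f -> submodular f -> submod_ratio f = 1.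
Proof.
move=> fM fS; apply: bigmin_eq_id => S _; apply: le_bigmin => // X _.
have sum0 : 0 <= \sum_(e in S) Defs.deriv f [set e] X.
  by apply: sumr_ge0 => e _; apply: deriv_ge0.
have leS := submodular_deriv_le _ S X fS; have d0 := deriv_ge0 S X fM.
rewrite /quot; case: ifP => // /negbT; rewrite negb_and.
have [dS0|dSn0] := eqVneq (Defs.deriv f S X) 0; last first.
  by rewrite ler_pdivlMr ?mul1r // lt_neqAle eq_sym dSn0.
rewrite orbF => /eqP[]; apply: big1 => e eS.
apply/eqP; rewrite eq_le deriv_ge0 // andbT -dS0 lerD2r.
by apply/fM/setSU; rewrite sub1set.
Qed.

End SubmodularityRatio.

(** * Elementary decompositions *)

Section Rank.
Set Implicit Arguments.

(** Its only nonzero mixed second differences are those involving i, and they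
    are positive: it is supermodular and yet {i}-submodular. *)
Definition card_if_mem (T : finType) (i : T) (S : {set T}) : nat :=
  ((i \in S) * #|S|)%N.

Lemma card_if_mem_supermodular (T : finType) (i : T) (X Y : {set T}) :
  (card_if_mem i X + card_if_mem i Y
     <= card_if_mem i (X :&: Y) + card_if_mem i (X :|: Y))%N.
Proof.
rewrite /card_if_mem !inE; have := cardsUI X Y.
have := subset_leq_card (subsetUl X Y); have := subset_leq_card (subsetUr X Y).
by case: (i \in X); case: (i \in Y) => /=; lia.
Qed.

Lemma card_if_mem_strict (T : finType) (i : T) (X Y : {set T}) :
  i \in X :\: Y -> ~~ (Y \subset X) ->
  (card_if_mem i X + card_if_mem i Y
     < card_if_mem i (X :&: Y) + card_if_mem i (X :|: Y))%N.
Proof.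
rewrite inE /card_if_mem !inE => /andP[/negbTE-> ->] nsYX /=.
rewrite mul0n !mul1n addn0 add0n; apply: proper_card.
by rewrite properE subsetUl subUset subxx.
Qed.

Lemma card_if_mem_elem_submodular (R : realType) (T : finType) (i : T) (K : R) :
  0 <= K -> elem_submodular i (fun S => K * (card_if_mem i S)%:R).
Proof.
move=> K0; apply/forallP=> X; apply/forallP=> Y.
rewrite -!mulrDr -!natrD ler_wpM2l // ler_nat.
have meetE : pi_meet (pred1 i) X Y =
    if (i \in X) || (i \in Y) then i |: (X :&: Y) else X :&: Y.
  apply/setP=> x; case: ifP => iXY; rewrite !inE; case: eqVneq => //= ->.
    by [].
  by rewrite iXY; move/negbT: iXY; rewrite negb_or => /andP[/negbTE->].
have joinE : pi_join (pred1 i) X Y =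
    if (i \in X) && (i \in Y) then X :|: Y else (X :|: Y) :\ i.
  apply/setP=> x; case: ifP => iXY; rewrite !inE; case: eqVneq => //= -> //.
  by case/andP: iXY => -> ->.
rewrite meetE joinE /card_if_mem; have := cardsUI X Y.
case iX: (i \in X); case iY: (i \in Y);
  rewrite /= ?in_setU1 ?in_setD1 ?in_setI ?in_setU ?eqxx ?iX ?iY /=.
- by move=> UI; rewrite cardsU1 inE iX iY !mul1n add0n addnC UI.
- rewrite cardsU1 inE iX iY /= !mul1n mul0n !addn0 add1n => _.
  apply: proper_card; rewrite properE subsetIl.
  by apply/subsetPn; exists i; rewrite // inE iX iY.
- rewrite cardsU1 inE iX iY /= !mul1n mul0n add0n addn0 add1n => _.
  apply: proper_card; rewrite properE subsetIr.
  by apply/subsetPn; exists i; rewrite // inE iX iY.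
- by rewrite !mul0n.
Qed.

(** Among two incomparable sets, the differences X :\: Y and Y :\: X cannot both
    consist of the omitted index [ord0] alone, so the sum of the remaining
    functions [card_if_mem i] is strictly supermodular with gap at least 1.
    Subtracting a large multiple K of it therefore makes any f submodular. *)
Lemma decomposition_pred (R : realType) n (f : {set 'I_n} -> R) :
  elem_decomposition f n.-1.
Proof.
case: n f => [|n] f.
  exists f, (fun j => j), (fun _ _ => 0); split=> [|[]//|S].
    apply/submodularP=> P Q; rewrite (_ : Q = P) ?setIid ?setUid //.
    by apply/setP=> -[].
  by rewrite big_ord0 addr0.
pose gap X Y := f (X :&: Y) + f (X :|: Y) - f X - f Y.
pose K := \sum_X \sum_Y `|gap X Y|.
have K0 : 0 <= K by do 2![apply: sumr_ge0 => ? _].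
have gapK X Y : gap X Y <= K.
  apply: le_trans (ler_norm _) _; rewrite /K (bigD1 X) //= (bigD1 Y) //=.
  by rewrite -addrA lerDl addr_ge0 //; do ?[apply: sumr_ge0 => ? _].
pose h (j : 'I_n) S := K * (card_if_mem (lift ord0 j) S)%:R.
exists (fun S => f S - \sum_j h j S), (lift ord0), h.
split=> [|j|S]; [|exact: card_if_mem_elem_submodular|by rewrite subrK].
apply/submodularP=> X Y.
have [sXY|nsXY] := boolP (X \subset Y).
  by rewrite (setIidPl sXY) (setUidPr sXY).
have [sYX|nsYX] := boolP (Y \subset X).
  by rewrite (setIidPr sYX) (setUidPl sYX) addrC.
pose N S := \sum_(j < n) card_if_mem (lift ord0 j) S.
have hE S : \sum_j h j S = K * (N S)%:R.
  by rewrite -mulr_sumr natr_sum.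
suff : (N X + N Y < N (X :&: Y) + N (X :|: Y))%N.
  rewrite -(ler_nat R) !hE -addn1 !natrD => /(ler_wpM2l K0).
  by rewrite !mulrDr mulr1; have := gapK X Y; rewrite /gap; lra.
rewrite -!big_split /=.
suff [j ltj] : exists j : 'I_n,
   (card_if_mem (lift ord0 j) X + card_if_mem (lift ord0 j) Y
     < card_if_mem (lift ord0 j) (X :&: Y)
       + card_if_mem (lift ord0 j) (X :|: Y))%N.
  rewrite (bigD1 j) // [X in (_ < X)%N](bigD1 j) //= -addSn leq_add //.
  by apply: leq_sum => k _; apply: card_if_mem_supermodular.
have [x xX xY] := subsetPn nsXY; have [y yY yX] := subsetPn nsYX.
case: (unliftP ord0 x) => [j xj|x0].
  by exists j; rewrite -xj; apply: card_if_mem_strict; rewrite // inE xX xY.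
case: (unliftP ord0 y) => [j yj|y0]; last by rewrite y0 -x0 xX in yX.
exists j; rewrite -yj addnC
  [X in (_ < X)%N](_ : _ = card_if_mem y (Y :&: X) + card_if_mem y (Y :|: X))%N.
  by apply: card_if_mem_strict; rewrite // inE yX yY.
by rewrite setIC setUC.
Qed.

(** Sets that agree on the indices of the decomposition have the same meet and
    join for the reversed orders as for the usual one. *)
Lemma decomposition_splits (R : realType) (T : finType) (f : {set T} -> R) r :
  elem_decomposition f r -> exists2 B : {set _}, (#|B| <= r)%N & splits f B.
Proof.
move=> [f0 [i [h [f0S hS fE]]]]; exists [set i j | j : 'I_r].
  by apply: leq_trans (leq_imset_card _ _) _; rewrite card_ord.
apply/splitsP=> X Y eqXY; rewrite !fE addrACA [leRHS]addrACA -!big_split /=.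
apply: lerD; first by move/submodularP: f0S; apply.
apply: ler_sum => j _; have /forallP/(_ X)/forallP/(_ Y) := hS j.
have ijXY : (i j \in X) = (i j \in Y).
  by move/setP/(_ (i j)): eqXY; rewrite !inE imset_f // !andbT.
congr (_ <= _); congr (h j _ + h j _); apply/setP=> x; rewrite !inE;
  by case: eqVneq => //= ->; rewrite ijXY ?orbb ?andbb.
Qed.

Lemma elem_submodular_rank_split (R : realType) n (f : {set 'I_n} -> R) r :
  elem_submodular_rank f r.+1 ->
  (r <= n.-1)%N /\ exists2 B : {set _}, (#|B| <= r)%N & splits f B.
Proof.
move=> [_ [[<-] fr rmin]]; split; last exact: decomposition_splits.
exact/rmin/decomposition_pred.
Qed.

Lemma set_extend (T : finType) (B : {set T}) r :
  (#|B| <= r <= #|T|)%N -> exists2 B' : {set T}, B \subset B' & #|B'| = r.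
Proof.
case/andP; elim: r => [|r IHr].
  by rewrite leqn0 => /eqP B0 _; exists B.
rewrite leq_eqVlt => /orP[/eqP Br _|leBr ltrT]; first by exists B.
have [B' sBB' B'r] := IHr leBr (ltnW ltrT).
have /set0Pn[e] : ~: B' != set0.
  by rewrite -card_gt0 -(ltn_add2l #|B'|) cardsC addn0 B'r.
rewrite inE => eB'; exists (e |: B'); last by rewrite cardsU1 eB' B'r.
exact: subset_trans sBB' (subsetUr _ _).
Qed.

Lemma alpha_split_attained (R : realType) (T : finType) (f : {set T} -> R) r :
  monotone f -> (exists2 B : {set _}, (#|B| <= r)%N & splits f B) ->
  exists B : {set T},
    [/\ (#|B| <= r)%N, splits f B & max_curvature f B = alpha_split f r].
Proof.
move=> fM [B0 B0r B0f].
have [||B /andP[Br fB] eqB] := @eq_bigmin _ _ _ (1 : R) B0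
  (fun B : {set T} => (#|B| <= r)%N && splits f B) (max_curvature f).
- by rewrite B0r.
- by move=> B _; apply: max_curvature_le1.
by exists B; split; rewrite // /alpha_split eqB.
Qed.

End Rank.

(** * Running the algorithm *)

Section QueryTrees.
Set Implicit Arguments.
Context {V : Type} {W : finType}.

Lemma exec_bind X Y (g : {set W} -> V) (t : qtree V W X) (h : X -> qtree V W Y) :
  exec g (bind t h) = exec g (h (exec g t)).
Proof. by elim: t => //= Q k IH; rewrite IH. Qed.

Lemma nqueries_bind X Y (g : {set W} -> V) (t : qtree V W X)
    (h : X -> qtree V W Y) :
  nqueries g (bind t h) = (nqueries g t + nqueries g (h (exec g t)))%N.
Proof. by elim: t => //= Q k IH; rewrite IH. Qed.

Lemma exec_reindex (W' : finType) X (phi : {set W} -> {set W'})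
    (g : {set W'} -> V) (t : qtree V W X) :
  exec g (Defs.reindex phi t) = exec (fun C => g (phi C)) t.
Proof. by elim: t => //= Q k IH; rewrite IH. Qed.

Lemma nqueries_reindex (W' : finType) X (phi : {set W} -> {set W'})
    (g : {set W'} -> V) (t : qtree V W X) :
  nqueries g (Defs.reindex phi t) = nqueries (fun C => g (phi C)) t.
Proof. by elim: t => //= Q k IH; rewrite IH. Qed.

End QueryTrees.

Section Split.
Set Implicit Arguments.
Context {R : realType} {T : finType}.
Implicit Types (f : {set T} -> R) (A B S : {set T}) (M : {set {set T}}).

(** The value carried along is f S, hence the third argument [f S] and not an
    arbitrary v: the comparisons are then comparisons of values of f. *)
Lemma best_of_ge (I : eqType) (F : I -> qtree R T {set T}) (s : seq I) f S c :
  f S <= f (exec f (best_of [seq F p | p <- s] S (f S) c)).1 /\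
  forall p, p \in s ->
    f (exec f (F p)) <= f (exec f (best_of [seq F p | p <- s] S (f S) c)).1.
Proof.
elim: s S c => [|p s IHs] S c //=; rewrite exec_bind /=.
case: ltP => [lt|le].
  have [leS les] := IHs (exec f (F p)) c.+1.
  split=> [|p']; first exact: le_trans (ltW lt) leS.
  by rewrite inE => /orP[/eqP->|/les].
have [leS les] := IHs S c.+1; split=> // p'.
by rewrite inE => /orP[/eqP->|/les//]; apply: le_trans leS.
Qed.

Lemma best_of_mem (I : eqType) (F : I -> qtree R T {set T}) (s : seq I) f M S v c :
  S \in M -> (forall p, p \in s -> exec f (F p) \in M) ->
  (exec f (best_of [seq F p | p <- s] S v c)).1 \in M.
Proof.
elim: s S v c => [|p s IHs] S v c //= SM FM; rewrite exec_bind /=.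
have FsM p' : p' \in s -> exec f (F p') \in M.
  by move=> ps; apply: FM; rewrite inE ps orbT.
by case: ifP => _; apply: IHs => //; apply: FM; rewrite mem_head.
Qed.

Lemma best_of_cost (ts : seq (qtree R T {set T})) f S v c :
  nqueries f (best_of ts S v c) = (\sum_(t <- ts) (nqueries f t).+1)%N /\
  (exec f (best_of ts S v c)).2 = (c + size ts)%N.
Proof.
elim: ts S v c => [|t ts IHts] S v c /=; first by rewrite big_nil addn0.
rewrite exec_bind nqueries_bind big_cons /= addnS -addSn.
by case: ifP => _; [have [-> ->] := IHts (exec f t) (f (exec f t)) c.+1
  | have [-> ->] := IHts S v c.+1];
  split=> //; rewrite addSnnS.
Qed.

Lemma exec_run_on_piece (Alg : algorithm R) M A B f :
  exec f (run_on_piece Alg M A B)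
  = in_piece A (exec (@piece R T f A B) (Alg (outside B) (piece_matroid M A B))).
Proof. by rewrite exec_bind exec_reindex. Qed.

Lemma nqueries_run_on_piece (Alg : algorithm R) M A B f :
  nqueries f (run_on_piece Alg M A B)
  = nqueries (@piece R T f A B) (Alg (outside B) (piece_matroid M A B)).
Proof. by rewrite nqueries_bind nqueries_reindex addn0. Qed.

Lemma split_costE (Alg : algorithm R) r M f :
  split_cost Alg r M f =
  (nqueries f (Alg T M) + 1 +
   \sum_(p <- split_pairs M r)
     (nqueries (@piece R T f p.1 p.2)
        (Alg (outside p.2) (piece_matroid M p.1 p.2)) + 2))%N.
Proof.
rewrite /split_cost /r_split exec_bind nqueries_bind /=.
have [-> ->] := best_of_cost [seq run_on_piece Alg M p.1 p.2 | p <- split_pairs M r]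
  f (exec f (Alg T M)) (f (exec f (Alg T M))) 0.
rewrite size_map add0n.
rewrite big_map addn1 addnS !addSn -addnA; congr (_ + _).+1.
rewrite -sum1_size -big_split /=.
by apply: eq_bigr => p _; rewrite nqueries_run_on_piece addn1 addn2.
Qed.

End Split.

(** * Counting pieces *)

Section Count.
Set Implicit Arguments.

Lemma bin_le_exp n r : ('C(n, r) <= n ^ r)%N.
Proof.
apply: (@leq_trans (n ^_ r)); first by rewrite -bin_ffact leq_pmulr ?fact_gt0.
elim: r => // r IHr; rewrite ffactnSr expnSr leq_mul //; exact: leq_subr.
Qed.

Lemma size_split_pairs (T : finType) (M : {set {set T}}) r :
  (size (split_pairs M r) <= 2 ^ r * #|T| ^ r)%N.
Proof.
rewrite size_filter -sum1_count big_enum_cond /=.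
apply: (@leq_trans (\sum_(B : {set T} | #|B| == r) \sum_(A : {set T} | A \subset B) 1)).
  rewrite pair_big_dep /=.
  rewrite (reindex_inj (h := fun p : {set T} * {set T} => (p.2, p.1))) /=;
    last first.
    by move=> [? ?] [? ?] [-> ->].
  rewrite [leqLHS]big_mkcond [leqRHS]big_mkcond; apply: leq_sum => -[B A] _ /=.
  by case: ifP => // /and3P[-> -> _].
rewrite (eq_bigr (fun=> 2 ^ r))%N; last first.
  move=> B /eqP <-; rewrite -card_powerset -sum1_card.
  by apply: eq_bigl => A; rewrite powersetE.
rewrite sum_nat_const mulnC leq_mul //.
rewrite (_ : #|_| = 'C(#|T|, r)) ?bin_le_exp // -card_draws.
by apply: eq_card => B; rewrite inE.
Qed.

End Count.

(** * Growth of polynomials at the positive integers *)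

Section PolynomialGrowth.
Set Implicit Arguments.
Context {R : realType}.
Implicit Types (q : {poly R}).

Lemma pos_min_nat (u : nat -> R) N :
  (forall n, 0 < u n) ->
  exists2 c, 0 < c & forall n, (n < N)%N -> c <= u n.
Proof.
move=> u0; exists (\big[Num.min/1]_(i < N) u i).
  by apply/bigmin_gtP; split.
by move=> n ltnN; exact: (bigmin_le 1 (Ordinal ltnN) (fun i : 'I_N => u i)).
Qed.

Lemma horner_upper q : exists2 C, 0 <= C &
  forall n, (0 < n)%N -> q.[n%:R] <= C * n%:R ^+ (size q).-1.
Proof.
exists (\sum_(i < size q) `|q`_i|) => [|n n0]; first by apply: sumr_ge0.
rewrite horner_coef mulr_suml; apply: ler_sum => i _.
apply: le_trans (ler_norm _) _; rewrite normrM normrX (ger0_norm (ler0n _ _)).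
by rewrite ler_wpM2l // ler_weXn2l ?ler1n // -ltnS (ltn_predK (ltn_ord i)).
Qed.

(** The terms below the leading one contribute at most B n^(d-1).  Positivity of
    q at large n forces the leading coefficient lc to be positive, so
    q(n) >= (lc / 2) n^d as soon as n > 2 B / lc; the finitely many smaller n
    are handled by taking a minimum. *)
Lemma horner_lower q : (forall n, (0 < n)%N -> 0 < q.[n%:R]) ->
  exists2 c, 0 < c &
  forall n, (0 < n)%N -> c * n%:R ^+ (size q).-1 <= q.[n%:R].
Proof.
move=> q0; have sq : size q = (size q).-1.+1.
  rewrite prednK // size_poly_gt0; apply/eqP=> qz.
  by have := q0 1%N isT; rewrite qz horner0 ltxx.
set d := (size q).-1 in sq *.
pose B := \sum_(i < d) `|q`_i|; have B0 : 0 <= B by apply: sumr_ge0.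
(* The factor n avoids the exponent d - 1, which is truncated when d = 0. *)
have low n : (0 < n)%N ->
    `|n%:R * (q.[n%:R] - q`_d * n%:R ^+ d)| <= B * n%:R ^+ d.
  move=> n0; rewrite horner_coef sq big_ord_recr /= addrK mulr_sumr mulr_suml.
  apply: le_trans (ler_norm_sum _ _ _) _; apply: ler_sum => i _.
  rewrite mulrCA -exprS normrM normrX (ger0_norm (ler0n _ _)).
  by rewrite ler_wpM2l // ler_weXn2l ?ler1n.
have lc_neq0 : q`_d != 0 by rewrite lead_coef_eq0 -size_poly_gt0 sq.
have pow0 n : (0 < n)%N -> 0 < n%:R ^+ d :> R.
  by move=> n0; rewrite exprn_gt0 // ltr0n.
have lc0 : 0 < q`_d.
  rewrite lt_neqAle eq_sym lc_neq0 leNgt; apply/negP => lcN.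
  have := archi_boundP (divr_ge0 B0 (ltW (etrans (oppr_gt0 _) lcN))).
  set n := Num.bound _ => ltn.
  have n0 : (0 < n)%N.
    rewrite -(ltr0n R); apply: le_lt_trans ltn.
    by rewrite divr_ge0 // oppr_ge0 ltW.
  move: ltn; rewrite ltr_pdivrMr ?oppr_gt0 // => ltn.
  have := le_trans (ler_norm _) (low n n0).
  have nR : (0 : R) < n%:R by rewrite ltr0n.
  have := mulr_gt0 nR (q0 n n0); have := ltr_pM2r (pow0 n n0) B (n%:R * - q`_d).
  rewrite ltn mulrBr; lra.
pose N := Num.bound (2 * B / q`_d).
(* The value at 0 is an arbitrary positive number. *)
pose u n := if n is n'.+1 then q.[n%:R] / n%:R ^+ d else 1.
have u0 n : 0 < u n by case: n => // n; rewrite divr_gt0 ?q0 ?pow0.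
have [c c0 cu] := pos_min_nat u N u0.
exists (Num.min c (q`_d / 2)); first by rewrite lt_min c0 divr_gt0.
case=> // n _; rewrite -ler_pdivlMr ?pow0 // ge_min.
case: (ltnP n.+1 N) => [/cu-> //|leNn]; apply/orP; right.
rewrite ler_pdivlMr ?pow0 //.
have := low n.+1 isT; rewrite ler_norml => /andP[+ _].
have ltn : 2 * B < n.+1%:R * q`_d.
  rewrite -ltr_pdivrMr //; apply: lt_le_trans (archi_boundP _) _.
    by rewrite divr_ge0 ?mulr_ge0 // ltW.
  by rewrite ler_nat.
have := ltr_pM2r (pow0 n.+1 isT) (2 * B) (n.+1%:R * q`_d).
have nR : (0 : R) < n.+1%:R by rewrite ltr0n.
rewrite ltn => ltB leB; rewrite -(ler_pM2l nR); lra.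
Qed.

Lemma horner_quasi_monotone q : (forall n, (0 < n)%N -> 0 < q.[n%:R]) ->
  exists2 C, 0 < C & forall m n, (0 < m <= n)%N -> q.[m%:R] <= C * q.[n%:R].
Proof.
move=> q0; have [C C0 qC] := horner_upper q; have [c c0 cq] := horner_lower q q0.
exists (C / c + 1) => [|m n /andP[m0 lemn]].
  by rewrite ltr_wpDl // divr_ge0 // ltW.
have n0 := leq_trans m0 lemn.
apply: le_trans (qC m m0) _; apply: (@le_trans _ _ (C / c * q.[n%:R])); last first.
  by rewrite ler_wpM2r ?lerDl // ltW // q0.
apply: le_trans (_ : C * n%:R ^+ (size q).-1 <= _).
  rewrite ler_wpM2l // lerXn2r ?nnegrE ?ler0n // ler_nat //.
by rewrite -mulrA ler_wpM2l // mulrC ler_pdivlMr // mulrC cq.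
Qed.

End PolynomialGrowth.

(** * Optimal values and approximation ratios *)

Section Ratio.
Set Implicit Arguments.
Context {R : realType} {T : finType}.
Implicit Types (f : {set T} -> R) (M : {set {set T}}).

Lemma opt_value_attained f M : nonnegative f -> set0 \in M ->
  exists2 S, S \in M & opt_value f M = f S.
Proof.
move=> f0 M0; have [S _|S SM eqS] := @eq_bigmax _ _ _ (0 : R) set0 (mem M) f M0.
  exact: f0.
by exists S.
Qed.

Lemma approx_ratio_le f M S S' : nonnegative f -> S' \in M ->
  f S <= f S' -> approx_ratio f M S <= approx_ratio f M S'.
Proof.
move=> f0 S'M leSS'; have leo : f S' <= opt_value f M by apply: le_bigmax_cond.
rewrite /approx_ratio /quot; have [o0|on0] := eqVneq (opt_value f M) 0.
  have e0 S'' : f S'' <= 0 -> f S'' = 0 by move=> ?; apply/eqP; rewrite eq_le f0 andbT.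
  by rewrite (e0 S') -?o0 // (e0 S) -?o0 ?(le_trans leSS').
rewrite !andbF ler_wpM2r // invr_ge0; exact: le_trans (f0 _) leo.
Qed.

(** The sets of the piece are independent in M, so its optimum cannot exceed that
    of f; the trace of the optimal set S attains it. *)
Lemma opt_value_piece f M S A B : nonnegative f -> S \in M ->
  opt_value f M = f S -> S :&: B = A ->
  opt_value (@piece R T f A B) (piece_matroid M A B) = opt_value f M.
Proof.
move=> f0 SM optS SA; apply/eqP; rewrite eq_le; apply/andP; split.
  apply: bigmax_le => [|C]; first exact: bigmax_ge_id.
  by rewrite inE => CM; rewrite /piece [leRHS]/opt_value le_bigmax_cond.
rewrite optS; apply: (bigmax_sup (trace B S)); last by rewrite /piece traceK.
by rewrite inE traceK.
Qed.

End Ratio.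

Theorem theorem25 (R : realType) (Alg : algorithm R) (q : {poly R})
    (ratio : R -> R -> R)
    (q_pos : forall m : nat, (0 < m)%N -> 0 < q.[m%:R])
    (Alg_queries : exists C : R,
       forall (W : finType) (M : {set {set W}}) (g : {set W} -> R),
         (0 < #|W|)%N -> matroid M -> monotone g -> nonnegative g ->
         (nqueries g (Alg W M))%:R <= C * q.[#|W|%:R])
    (Alg_ratio :
       forall (W : finType) (M : {set {set W}}) (g : {set W} -> R),
         matroid M -> monotone g -> nonnegative g ->
         exec g (Alg W M) \in M /\
         ratio (gen_curvature g) (submod_ratio g)
           <= approx_ratio g M (exec g (Alg W M)))
    (ratio_antitone : forall a b : R,
       0 <= a -> a <= b -> b <= 1 -> ratio b 1 <= ratio a 1) :
  (exists C : R,
     forall (n r : nat) (M : {set {set 'I_n}}) (f : {set 'I_n} -> R),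
       (0 < n)%N -> matroid M -> monotone f -> nonnegative f ->
       elem_submodular_rank f r.+1 ->
       (split_cost Alg r M f)%:R <= C * (2 ^+ r * n%:R ^+ r * q.[n%:R]))
  /\
  (forall (n r : nat) (M : {set {set 'I_n}}) (f : {set 'I_n} -> R),
     matroid M -> monotone f -> nonnegative f ->
     elem_submodular_rank f r.+1 ->
     [/\ split_solution Alg r M f \in M,
         Order.max (ratio (gen_curvature f) (submod_ratio f))
                   (ratio (alpha_split f r) 1)
           <= approx_ratio f M (split_solution Alg r M f) &
         alpha_r f r = alpha_split f r ->
         Order.max (ratio (gen_curvature f) (submod_ratio f))
                   (ratio (alpha_r f r) 1)
           <= approx_ratio f M (split_solution Alg r M f)]).
Proof.
split.
  have [D qD] := Alg_queries; have [C C0 qC] := horner_quasi_monotone q q_pos.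
  have q1 : 0 < q.[1%:R] by apply: q_pos.
  (* The first summand pays for the queries of a run on at most n variables, the
     second for one additional query or comparison. *)
  pose E := `|D| * C + C / q.[1%:R].
  (* One share of E for the run on f, two for each piece. *)
  exists (3 * E) => n r M f n0 Mm fM f0 /elem_submodular_rank_split[ltrn _].
  have qn := q_pos n n0.
  have bound (W : finType) (M' : {set {set W}}) (g : {set W} -> R) :
      (0 < #|W| <= n)%N -> matroid M' -> monotone g -> nonnegative g ->
      (nqueries g (Alg W M') + 1)%:R <= E * q.[n%:R].
    move=> /andP[W0 Wn] M'm gM g0; rewrite natrD /E mulrDl lerD //.
      apply: le_trans (qD _ _ _ W0 M'm gM g0) _.
      apply: le_trans (_ : `|D| * q.[#|W|%:R] <= _).
        by rewrite ler_wpM2r ?ler_norm // ltW // q_pos.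
      by rewrite -mulrA ler_wpM2l // qC // W0.
    by rewrite mulrAC ler_pdivlMr // mul1r qC.
  have E0 : 0 <= E * q.[n%:R].
    by rewrite mulr_ge0 ?(ltW qn) // addr_ge0 ?mulr_ge0 ?invr_ge0 // ltW.
  set Q := E * _ in bound E0.
  have one : 1 <= 2 ^+ r * n%:R ^+ r :> R.
    by rewrite -natrX -natrX -natrM ler1n muln_gt0 !expn_gt0 n0.
  rewrite split_costE natrD natr_sum.
  have Alg_f : (nqueries f (Alg _ M) + 1)%:R <= Q.
    by apply: bound; rewrite ?card_ord ?n0 /=.
  have pieces : \sum_(p <- split_pairs M r)
     (nqueries (@piece R _ f p.1 p.2)
        (Alg (outside p.2) (piece_matroid M p.1 p.2)) + 2)%:R
     <= (2 ^+ r * n%:R ^+ r) * (2 * Q).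
    apply: (@le_trans _ _ (\sum_(p <- split_pairs M r) 2 * Q)).
      rewrite big_seq [leRHS]big_seq; apply: ler_sum => -[A B] /=.
      rewrite mem_filter /= => /andP[/and3P[sAB /eqP Br MAB] _].
      have Q1 := bound _ (piece_matroid M A B) (@piece R _ f A B) _
        (piece_matroid_matroid sAB Mm MAB) (piece_monotone A fM) (piece_nonnegative A f0).
      set k := nqueries _ _ in Q1 *.
      have {}Q1 : (k + 1)%:R <= Q.
        by apply: Q1; rewrite card_outside card_ord Br leq_subr; lia.
      by move: Q1 (ler0n R k); rewrite !natrD; lra.
    rewrite big_const_seq count_predT iter_addr_0 -[leLHS]mulr_natl.
    rewrite ler_wpM2r ?(mulr_ge0 (ler0n _ 2) E0) //.
    by rewrite -!natrX -natrM ler_nat; have := size_split_pairs M r; rewrite card_ord.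
  apply: le_trans (lerD Alg_f pieces) _.
  have := ler_wpM2r E0 one; rewrite -/Q mul1r.
  rewrite (_ : 3 * E * _ = 3 * (2 ^+ r * n%:R ^+ r * Q)); last by rewrite /Q; ring.
  lra.
move=> n r M f Mm fM f0 /elem_submodular_rank_split[ltrn rk].
have [M0 _ _] := Mm.
have [AM Aratio] := Alg_ratio _ _ f Mm fM f0.
pose F (p : {set 'I_n} * {set 'I_n}) := run_on_piece Alg M p.1 p.2.
have pieceP (A B : {set 'I_n}) : A \subset B -> piece_matroid M A B != set0 ->
    exec f (F (A, B)) \in M /\
    ratio (gen_curvature (@piece R _ f A B)) (submod_ratio (@piece R _ f A B))
    <= quot (f (exec f (F (A, B))))
            (opt_value (@piece R _ f A B) (piece_matroid M A B)).
  move=> sAB MAB; have [] := Alg_ratio _ _ (@piece R _ f A B)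
    (piece_matroid_matroid sAB Mm MAB) (piece_monotone A fM) (piece_nonnegative A f0).
  by rewrite exec_run_on_piece inE.
set S := split_solution Alg r M f.
have SE : S = (exec f (best_of [seq F p | p <- split_pairs M r]
    (exec f (Alg _ M)) (f (exec f (Alg _ M))) 0)).1.
  by rewrite /S /split_solution /r_split exec_bind.
have SM : S \in M.
  rewrite SE; apply: best_of_mem => // -[A B].
  by rewrite mem_filter => /andP[/and3P[sAB _ MAB] _]; have [] := pieceP A B sAB MAB.
have [AlgS FS] := best_of_ge _ F (split_pairs M r) f (exec f (Alg _ M)) 0.
rewrite -SE in AlgS FS.
suff main : Order.max (ratio (gen_curvature f) (submod_ratio f))
    (ratio (alpha_split f r) 1) <= approx_ratio f M S.
  by split=> // ->.
rewrite ge_max (le_trans Aratio) ?approx_ratio_le //=.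
have [B0 [B0r fB0 B0E]] := alpha_split_attained r fM rk.
have [|B sB0B Br] := @set_extend _ B0 r.
  by rewrite B0r card_ord (leq_trans ltrn) // leq_pred.
have fB := splitsS _ sB0B fB0.
(* The piece of the optimal set O along B is the one whose run is good enough. *)
have [O OM OE] := opt_value_attained f0 M0.
pose A := O :&: B; have sAB : A \subset B by apply: subsetIr.
have MAB : piece_matroid M A B != set0.
  by apply/set0Pn; exists (trace B O); rewrite inE traceK.
have [CM Cratio] := pieceP A B sAB MAB.
have ABr : (A, B) \in split_pairs M r.
  by rewrite mem_filter sAB Br eqxx MAB mem_enum.
apply: le_trans _ (approx_ratio_le _ f0 SM (FS _ ABr)).
rewrite /approx_ratio -(opt_value_piece (A := A) (B := B) f0 OM OE erefl).
apply: le_trans _ Cratio.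
have pM : monotone (@piece R _ f A B) by apply: piece_monotone.
rewrite submod_ratio1 //; last by have /forallP/(_ A)/implyP := fB; apply.
apply: ratio_antitone.
- exact: gen_curvature_ge0.
- rewrite -B0E; apply: le_trans _ (max_curvatureS fM sB0B).
  exact: le_bigmax_cond.
- exact: bigmin_le_id.
Qed.
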